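(* For $n\ge1$ and $q$ a prime power, let $X=\mathbb{F}_q^n$. Then the reduced Euler characteristic of the order complex of $\overline{\mathcal{O}\mathcal{PD}(X)}$ equals $-q^{n(n-1)}$.
   Context: $\mathcal{O}\mathcal{PD}(X)$ is the poset of tuples $(V_1,\dots,V_r)$, $r\ge0$, of pairwise distinct nonzero subspaces of $X$ whose sum is direct (i.e. $\dim(V_1+\cdots+V_r)=\sum_i\dim V_i$), ordered by $(V_1,\dots,V_r)\le(W_1,\dots,W_s)$ iff for all $1\le i\le j\le r$ there exist $k\le l$ with $V_i\subseteq W_k$ and $V_j\subseteq W_l$. It has minimum $()$ and maximum $(X)$; $\overline{\mathcal{O}\mathcal{PD}(X)}$ denotes the poset with these two elements removed. *)

(* Defs.v *)
From HB Require Import structures.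
From mathcomp Require Import all_boot all_order all_algebra.

Set Implicit Arguments.
Unset Strict Implicit.
Unset Printing Implicit Defensive.

Import Order.TTheory GRing.Theory Num.Theory.

Local Open Scope ring_scope.

(* Simplicial complexes on a finite vertex type are given by their sets of
   faces, the empty face (of dimension -1) included. *)

Definition order_complex (d : Order.disp_t) (T : finPOrderType d)
    (A : {set T}) : {set {set T}} :=
  [set c : {set T} | (c \subset A) &&
     [forall x in c, forall y in c, (x >=< y)%O]].

(* A face with m vertices has dimension m - 1, computed in int, so that the
   empty face contributes (-1) ^ (-1) = -1. *)
Definition reduced_euler (T : finType) (K : {set {set T}}) : int :=
  \sum_(c in K) (-1) ^ (#|c|%:Z - 1).

Section FiniteVspace.
Variables (F : finFieldType) (vT : vectType F).

HB.instance Definition _ :=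
  CanIsCountable (@VectorInternalTheory.vs2mxK F vT).
HB.instance Definition _ := isFinite.Build {vspace vT}
  (pcan_enumP (can_pcan (@VectorInternalTheory.vs2mxK F vT))).

End FiniteVspace.

Fact opd_display : Order.disp_t. Proof. exact: Order.Disp tt tt. Qed.

Section OrderedPartialDecompositions.
Variables (F : finFieldType) (vT : vectType F).
Implicit Types s t u : seq {vspace vT}.

Definition is_opd s : bool :=
  [&& uniq s, 0%VS \notin s &
      \dim (\sum_(V <- s) V)%VS == (\sum_(V <- s) \dim V)%N].

Definition opd_le_seq s t : bool :=
  [forall i : 'I_(size s), forall j : 'I_(size s), (i <= j)%N ==>
     [exists k : 'I_(size t), exists l : 'I_(size t),
        [&& (k <= l)%N, (nth 0%VS s i <= nth 0%VS t k)%VS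
          & (nth 0%VS s j <= nth 0%VS t l)%VS]]].

Record opd := OPD { opd_seq :> seq {vspace vT}; opdP : is_opd opd_seq }.

HB.instance Definition _ := [isSub for opd_seq].
HB.instance Definition _ := [Countable of opd by <:].

Lemma opd_size (x : opd) : (size x <= \dim {:vT})%N.
Proof.
case: x => s /=; case/and3P=> _ nz /eqP dimE.
apply: leq_trans (dimvS (subvf (\sum_(V <- s) V)%VS)); rewrite dimE.
elim: s nz {dimE} => [|V s IHs] //=.
rewrite inE negb_or eq_sym -dimv_eq0 -lt0n big_cons => /andP[V0 /IHs].
by rewrite -add1n; apply: leq_add.
Qed.

Definition bseq_of_opd (x : opd) : (\dim {:vT}).-bseq {vspace vT} :=
  Bseq (opd_size x).
Definition opd_of_bseq (b : (\dim {:vT}).-bseq {vspace vT}) : option opd :=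
  insub (b : seq {vspace vT}).

Lemma bseq_of_opdK : pcancel bseq_of_opd opd_of_bseq.
Proof. by move=> x; rewrite /opd_of_bseq /= valK. Qed.

HB.instance Definition _ := isFinite.Build opd (pcan_enumP bseq_of_opdK).

Lemma opd_le_seqP s t :
  reflect (forall i j, (i <= j < size s)%N -> exists k l,
             [/\ (k <= l < size t)%N, (nth 0%VS s i <= nth 0%VS t k)%VS
               & (nth 0%VS s j <= nth 0%VS t l)%VS])
          (opd_le_seq s t).
Proof.
apply: (iffP 'forall_'forall_implyP) => [le_st i j /andP[ij js] | le_st i j ij].
  have /existsP[k /existsP[l /and3P[kl ik jl]]] :=
    le_st (Ordinal (leq_ltn_trans ij js)) (Ordinal js) ij.
  by exists k, l; rewrite kl ltn_ord.
have [|k [l [/andP[kl lt] ik jl]]] := le_st i j; first by rewrite ij ltn_ord.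
apply/existsP; exists (Ordinal (leq_ltn_trans kl lt)).
by apply/existsP; exists (Ordinal lt); rewrite kl ik.
Qed.

Lemma opd_inj_nth s V i j : is_opd s -> (i < size s)%N -> (j < size s)%N ->
  V != 0%VS -> (V <= nth 0 s i)%VS -> (V <= nth 0 s j)%VS -> i = j.
Proof.
case/and3P=> _ _ /eqP dimE si sj V0 Vi Vj; apply/eqP/negPn/negP=> neq_ij.
have /directv_sumP/(_ (Ordinal si) isT) :
    directv (\sum_(k < size s) nth 0%VS s k)%VS.
  rewrite directvE /=; move: dimE.
  by rewrite !(big_nth 0%VS) !big_mkord => ->.
move=> cap0; case/negP: V0; rewrite -subv0 -cap0 subv_cap Vi /=.
apply: subv_trans Vj _; apply: (sumv_sup (Ordinal sj)) => //.
by rewrite /= -val_eqE /= eq_sym.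
Qed.

Lemma opd_le_mono s t : is_opd s -> is_opd t ->
    opd_le_seq s t -> opd_le_seq t s ->
  {subset s <= t} /\ {in s &, forall V W, (index V s < index W s)%N ->
                                          (index V t < index W t)%N}.
Proof.
move=> os ot /opd_le_seqP st /opd_le_seqP ts.
have nz i : (i < size s)%N -> nth 0%VS s i != 0%VS.
  move=> si; case/and3P: os => _ s0 _; apply: contraNneq s0 => <-.
  exact: mem_nth.
have eq_sub i k : (i < size s)%N -> (k < size t)%N ->
    (nth 0 s i <= nth 0 t k)%VS -> nth 0%VS s i = nth 0%VS t k.
  move=> si tk ik; have [|m [l [/andP[ml ls] km _]]] := ts k k.
    by rewrite leqnn.
  have sm := leq_ltn_trans ml ls.
  have im := opd_inj_nth os si sm (nz i si) (subvv _) (subv_trans ik km).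
  by apply/eqP; rewrite eqEsubv ik im km.
split=> [V Vs | V W Vs Ws ltVW].
  have si : (index V s < size s)%N by rewrite index_mem.
  have [|k [l [/andP[kl tl] ik _]]] := st (index V s) (index V s).
    by rewrite leqnn.
  have tk := leq_ltn_trans kl tl.
  by rewrite -(nth_index 0%VS Vs) (eq_sub _ _ si tk ik) mem_nth.
have sj : (index W s < size s)%N by rewrite index_mem.
have si := ltn_trans ltVW sj.
have [|k [l [/andP[kl tl] ik jl]]] := st (index V s) (index W s).
  by rewrite (ltnW ltVW).
have tk := leq_ltn_trans kl tl.
have /and3P[ut _ _] := ot.
have := eq_sub _ _ si tk ik; have := eq_sub _ _ sj tl jl.
rewrite !nth_index // => EW EV; move: ltVW; rewrite EV EW !index_uniq //.
by case: (ltngtP k l) kl => // ->; rewrite ltnn.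
Qed.

Definition opd_le (x y : opd) : bool := opd_le_seq x y.

Lemma opd_le_refl : reflexive opd_le.
Proof.
by move=> x; apply/opd_le_seqP => i j ij; exists i, j; rewrite ij !subvv.
Qed.

Lemma opd_le_trans : transitive opd_le.
Proof.
move=> y x z /opd_le_seqP xy /opd_le_seqP yz; apply/opd_le_seqP=> i j ij.
have [k [l [kl ik jl]]] := xy i j ij.
have [m [p [mp km lp]]] := yz k l kl.
by exists m, p; split=> //; [apply: subv_trans km | apply: subv_trans lp].
Qed.

Lemma opd_le_anti : antisymmetric opd_le.
Proof.
move=> [s os] [t ot] /andP[/= st ts]; apply: val_inj => /=.
have [sub_st mono] := opd_le_mono os ot st ts.
have [sub_ts _] := opd_le_mono ot os ts st.
pose lt V W := (index V t < index W t)%N.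
have sorted_idx u : uniq u -> sorted (fun V W => index V u < index W u)%N u.
  move=> uu; apply/(sortedP 0%VS) => i iu.
  by rewrite !index_uniq // ltnW.
have /and3P[us _ _] := os; have /and3P[ut _ _] := ot.
apply: (@irr_sorted_eq _ lt).
- by move=> V W U; apply: ltn_trans.
- by move=> V; rewrite /lt ltnn.
- by apply: sub_in_sorted (sorted_idx s us); [move=> V W; apply: mono | apply/allP].
- exact: sorted_idx.
- by move=> V; apply/idP/idP; [apply: sub_st | apply: sub_ts].
Qed.

HB.instance Definition _ := Order.Le_isPOrder.Build
  opd_display opd opd_le_refl opd_le_anti opd_le_trans.

Lemma opd_min (x y : opd) : x = [::] :> seq _ -> (x <= y)%O.
Proof. by move=> x0; apply/opd_le_seqP; rewrite x0 => i j; rewrite ltn0 andbF. Qed.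

Lemma opd_max (x y : opd) : y = [:: fullv] :> seq _ -> (x <= y)%O.
Proof.
by move=> y1; apply/opd_le_seqP; rewrite y1 => i j _; exists 0, 0; rewrite /= !subvf.
Qed.

Definition opd_proper : {set opd} :=
  [set x : opd | (opd_seq x != [::]) && (opd_seq x != [:: fullv])].

End OrderedPartialDecompositions.

Arguments opd {F} vT.
Arguments opd_proper {F} vT.

(* Main.v *)
Require Import Defs.
From mathcomp Require Import all_boot all_order all_algebra all_field.
From mathcomp Require Import ring zify.

Set Implicit Arguments.
Unset Strict Implicit.
Unset Printing Implicit Defensive.

Import Order.TTheory GRing.Theory Num.Theory.
Local Open Scope ring_scope.

(* By Philip Hall's theorem the reduced Euler characteristic is the Moebius
   function of the poset at its maximum, and [weight], the product over the
   blocks V of - q^(d(d-1)) with d = dim V, is the Moebius function from the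
   minimum: its sum over a nontrivial lower interval vanishes. The tuples below
   (W, W_2, ..., W_s) with prescribed part outside W range freely over the
   ordered partial decompositions of W, so it is enough to sum over those. More
   generally, over the tuples of subspaces of U independent of C <= U, with
   c = dim C and n = dim U, the sum of the weights is the product of the
   1 - q^i, c <= i < n. Removing the first block gives a recursion on C which,
   after counting the subspaces of U that meet C trivially, is a finite form of
   Cauchy's identity. *)

(** * Chains and reduced Euler characteristics of order complexes *)

Section Chains.
Variables (d : Order.disp_t) (T : finPOrderType d).
Implicit Types (A c : {set T}).

Lemma order_complexP A c : reflect
  (c \subset A /\ {in c &, forall x y, x >=< y}%O) (c \in order_complex A).
Proof.
rewrite inE; apply: (iffP andP) => -[cA cc]; split=> //.
  by move=> x y xc yc; move: cc => /forall_inP/(_ x xc)/forall_inP/(_ y yc).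
by apply/forall_inP=> x xc; apply/forall_inP=> y yc; apply: cc.
Qed.

Lemma chain_has_max A c : c \in order_complex A -> c != set0 ->
  exists2 y, y \in c & {in c, forall z, z <= y}%O.
Proof.
case/order_complexP=> _ cc /set0Pn[x0 x0c].
(* [h y] counts the members of [c] below [y]; where it is largest, no comparable [z] can lie
   strictly above [y]. *)
pose h (y : T) := #|[set z in c | (z <= y)%O]|.
case: (@arg_maxnP _ x0 (mem c) h x0c) => y yc ymax.
exists y => // z zc; have := cc z y zc yc; rewrite /Order.comparable.
case/orP=> // yz; have := ymax z zc; rewrite /h => hzy.
have sub : [set z0 in c | (z0 <= y)%O] \subset [set z0 in c | (z0 <= z)%O].
  by apply/subsetP=> t; rewrite !inE => /andP[-> /le_trans->].
have /setP/(_ z) : [set z0 in c | (z0 <= y)%O] = [set z0 in c | (z0 <= z)%O].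
  by apply/eqP; rewrite eqEcard sub.
by rewrite !inE zc lexx.
Qed.

(** Nonempty chains are sorted by their maximum [y]; deleting [y] leaves a chain strictly below [y]
    and flips the sign. The empty chain gives the -1. *)
Lemma reduced_euler_recl A :
  reduced_euler (order_complex A) =
  -1 - \sum_(y in A) reduced_euler (order_complex [set z in A | (z < y)%O]).
Proof.
rewrite /reduced_euler (bigD1 set0) /=; last first.
  by apply/order_complexP; split; [apply: sub0set | move=> x; rewrite inE].
rewrite cards0 sub0r -sumrN; congr (_ + _).
pose top y c := (y \in c) && [forall z in c, (z <= y)%O].
transitivity (\sum_(c in order_complex A | c != set0) \sum_(y in A | top y c)
    (-1 : int) ^ (#|c|%:Z - 1)).
  apply: eq_bigr => c /andP[cA c0].
  have [y yc ymax] := chain_has_max cA c0.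
  rewrite (big_pred1 y) // => z; apply/andP/eqP=> [[_ /andP[zc /forall_inP zmax]]|->].
    by apply/le_anti; rewrite ymax // zmax.
  have /order_complexP[/subsetP cA' _] := cA.
  by rewrite cA' // /top yc; split=> //; apply/forall_inP.
rewrite (exchange_big_dep (mem A)) /=; last by move=> ? ? _ /andP[].
apply: eq_bigr => y yA.
rewrite (reindex_onto (fun c => y |: c) (fun c => c :\ y)) /=; last first.
  by move=> c /and3P[_ _ /andP[yc _]]; rewrite setD1K.
rewrite -sumrN; apply: eq_big => [c | c /andP[_ /eqP yc]]; last first.
  have ync : y \notin c by rewrite -yc !inE eqxx.
  rewrite cardsU1 ync PoszD; have -> : 1%:Z + #|c|%:Z - 1 = (#|c|%:Z - 1) + 1 by ring.
  by rewrite exprzDr ?unitrN1 // expr1z mulrN1.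
apply/andP/order_complexP => [[] | [cA cc]].
  case/and3P=> /andP[/order_complexP[/subsetP cA cc] _] yA' /andP[_ /forall_inP ymax] /eqP yc.
  have ync : y \notin c by rewrite -yc !inE eqxx.
  split=> [|x z xc zc]; last by apply: cc; rewrite !inE ?xc ?zc orbT.
  apply/subsetP=> z zc; rewrite inE cA ?lt_neqAle ?ymax ?inE ?zc ?orbT // andbT /=.
  by apply: contraNneq ync => <-.
have lty z : z \in c -> (z < y)%O by move/(subsetP cA); rewrite inE => /andP[].
have ync : y \notin c by apply/negP => /lty; rewrite ltxx.
split; last by rewrite setU1K.
rewrite yA /top setU11 /=; apply/andP; split.
- apply/andP; split; last by apply/set0Pn; exists y; rewrite setU11.
  apply/order_complexP; split.
    rewrite subUset sub1set yA; apply: subset_trans cA _.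
    by apply/subsetP=> z; rewrite inE => /andP[].
  move=> x z /setU1P[->|xc] /setU1P[->|zc].
  + exact: comparablexx.
  + by rewrite comparable_sym lt_comparable ?lty.
  + by rewrite lt_comparable ?lty.
  + exact: cc.
- by apply/forall_inP=> z /setU1P[->|/lty/ltW].
Qed.

(* Philip Hall's theorem: [f] plays the role of the Moebius function from an
   added minimum, at which its value is 1. *)
Lemma reduced_euler_moebius A (f : T -> int) :
    {in A, forall x, f x = -1 - \sum_(y in A | (y < x)%O) f y} ->
  reduced_euler (order_complex A) = -1 - \sum_(y in A) f y.
Proof.
have [m] := ubnP #|A|; elim: m A => // m IHm A leAm fE.
rewrite reduced_euler_recl; congr (_ - _); apply: eq_bigr => y yA.
rewrite IHm.
- by rewrite fE //; congr (_ - _); apply: eq_bigl => z; rewrite inE.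
- rewrite -ltnS; apply: leq_trans leAm; rewrite ltnS; apply: proper_card.
  apply/properP; split; first by apply/subsetP=> z; rewrite inE => /andP[].
  by exists y; rewrite ?inE ?ltxx ?andbF.
move=> x; rewrite inE => /andP[xA xy]; rewrite fE //; congr (_ - _).
apply: eq_bigl => z; rewrite inE -andbA; congr (_ && _).
by apply/idP/andP=> [zx|[]//]; split=> //; apply: lt_trans xy.
Qed.

End Chains.

(** * Gaussian binomial coefficients and Cauchy's identity *)

Section QIdentity.
Variables (R : comPzRingType) (q : R).

(** The Gaussian binomial coefficient, given by a Pascal rule to avoid division. The truncation in
    [m - d'] is harmless, as [qbin m d'] vanishes for [m < d']. *)
Fixpoint qbin (m d : nat) : R :=
  match m, d with
  | _, 0 => 1
  | 0, _.+1 => 0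
  | m.+1, d'.+1 => qbin m d + q ^+ (m - d') * qbin m d'
  end.

Lemma qbin0 m : qbin m 0 = 1. Proof. by case: m. Qed.

Lemma qbinS m d : qbin m.+1 d.+1 = qbin m d.+1 + q ^+ (m - d) * qbin m d.
Proof. by []. Qed.

Lemma qbin_small m d : (m < d)%N -> qbin m d = 0.
Proof.
elim: m d => [|m IHm] [|d] //= lt_md.
by rewrite IHm ?(ltnW lt_md) // IHm ?mulr0 ?addr0.
Qed.

Lemma qbin_ffact m d : (d <= m)%N ->
  qbin m d * \prod_(i < d) (q ^+ d - q ^+ i) = \prod_(i < d) (q ^+ m - q ^+ i).
Proof.
elim: m d => [|m IHm] [|d] // le_dm; rewrite ?qbin0 ?big_ord0 ?mulr1 //.
have PS M D : \prod_(i < D.+1) (q ^+ M.+1 - q ^+ i) =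
    (q ^+ M.+1 - 1) * (q ^+ D * \prod_(i < D) (q ^+ M - q ^+ i)).
  rewrite big_ord_recl /= expr0; congr (_ * _).
  rewrite -[in q ^+ D](card_ord D) -prodr_const -big_split /=.
  by apply: eq_bigr => i _; rewrite !exprS mulrBr.
(* The induction hypothesis, extended to [d = m], where [qbin m d.+1] and the factor [i = m] both
   vanish. *)
have step : qbin m d.+1 * \prod_(i < d.+1) (q ^+ d.+1 - q ^+ i) =
    \prod_(i < d.+1) (q ^+ m - q ^+ i).
  have := le_dm; rewrite ltnS leq_eqVlt => /orP[/eqP->|]; last exact: IHm.
  by rewrite qbin_small // mul0r big_ord_recr /= subrr mulr0.
rewrite qbinS mulrDl step PS (PS m) big_ord_recr /= -IHm // !exprS.
have -> : q ^+ m = q ^+ (m - d) * q ^+ d by rewrite -exprD subnK.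
ring.
Qed.

(* A finite form of Cauchy's identity. By the Pascal rule [qbinS], the sum E(m, x)
   satisfies E(m+1, x) = (1 - x q^m) E(m, x) + x q^m E(m, q x). *)
Lemma qbin_cauchy m x :
  \sum_(d < m.+1) x ^+ d * q ^+ (d * d.-1) * qbin m d *
     \prod_(d <= i < m) (1 - x * q ^+ i) = 1.
Proof.
elim: m x => [|m IHm] x.
  by rewrite big_ord1 big_geq // qbin0 !mulr1.
rewrite big_ord_recl /= !expr0 !mul1r.
pose E y d := y ^+ d * q ^+ (d * d.-1) * qbin m d * \prod_(d <= i < m) (1 - y * q ^+ i).
transitivity ((1 - x * q ^+ m) * \sum_(d < m.+1) E x d
    + x * q ^+ m * \sum_(d < m.+1) E (x * q) d); last by rewrite !IHm; ring.
(* Apart from the term at 0, the two summands of the Pascal rule at [d.+1] match the term [d.+1] of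
   the sum at [x] and the term [d] of the sum at [x * q]. *)
rewrite [X in _ = (_ * X) + _]big_ord_recl mulrDr -addrA; congr (_ + _).
  by rewrite /E big_nat_recr //= qbin0 expr0; ring.
have -> : \sum_(i < m) E x (lift ord0 i) = \sum_(i < m.+1) E x i.+1.
  by rewrite big_ord_recr /= [E x m.+1]/E qbin_small // mulr0 mul0r addr0.
rewrite !mulr_sumr -big_split; apply: eq_bigr => d _.
have dm : (d <= m)%N by rewrite -ltnS.
rewrite /bump /= add1n /E -/(qbin m.+1 d.+1) qbinS mulrDr mulrDl; congr (_ + _).
  move: dm; rewrite leq_eqVlt => /orP[/eqP->|dm]; first by rewrite qbin_small //; ring.
  by rewrite big_nat_recr //=; ring.
rewrite big_add1 /=.
rewrite [in RHS](eq_bigr (fun i => 1 - x * q ^+ i.+1)); last first.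
  by move=> i _; rewrite -mulrA -exprS.
have qE : q ^+ (d.+1 * d) * q ^+ (m - d) = q ^+ m * q ^+ d * q ^+ (d * d.-1).
  by rewrite -!exprD; congr (q ^+ _); case: (d : nat) dm => [|k] ?; nia.
rewrite exprMn exprS; ring: qE.
Qed.

End QIdentity.

(** * Counting the subspaces of [U] that meet [C] trivially *)

Section CountSubspaces.
Variables (F : finFieldType) (vT : vectType F).
Implicit Types (U C V : {vspace vT}).
Local Notation q := (#|F|%:Z).
Local Notation fT := (finvect_type vT).

Lemma dimv_add_line C (v : vT) : v \notin C -> \dim (C + <[v]>) = (\dim C).+1.
Proof.
move=> vC; rewrite dimv_disjoint_sum; last first.
  apply/eqP; rewrite -subv0; apply/subvP=> w; rewrite memv_cap => /andP[wC].
  case/vlineP=> k def_w; move: wC; rewrite def_w memv0.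
  by rewrite rpredZeq (negPf vC) orbF => /eqP->; rewrite scale0r.
by rewrite dim_vline; have [v0|] := eqVneq v 0; rewrite ?addn1 // v0 mem0v in vC *.
Qed.

(** The dimension equality encodes linear independence of [X] modulo [C]. *)
Definition free_mod C U (X : seq vT) :=
  all [in U] X && (\dim (C + <<X>>) == \dim C + size X)%N.

Lemma free_mod_cons C U v X :
  free_mod C U (v :: X) = [&& v \in U, v \notin C & free_mod (C + <[v]>) U X].
Proof.
rewrite /free_mod /= span_cons addvA -!andbA; case: (v \in U) => //=.
have [vC | vC] /= := boolP (v \in C).
  have /addv_idPl-> : (<[v]> <= C)%VS by rewrite -memvE.
  apply/negbTE/negP => /andP[_ /eqP].
  move=> eq_dim; have := leq_trans (dimv_add_leqif C <<X>>).1 (leq_add (leqnn _) (dim_span X)).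
  by rewrite eq_dim addnS ltnn.
by rewrite dimv_add_line // addnS.
Qed.

Lemma card_vector U : \sum_(v : fT | v \in U) (1 : int) = q ^+ \dim U.
Proof.
rewrite sumr_const -[q]natz -natrX; congr _%:R.
case: vT U => sT cT U.
by rewrite -(@card_vspace F (finvect_type (Vector.Pack cT)) cT U).
Qed.

Lemma card_vspaceD C U : (C <= U)%VS ->
  \sum_(v : fT | (v \in U) && (v \notin C)) (1 : int) = q ^+ \dim U - q ^+ \dim C.
Proof.
move=> CU.
rewrite -!card_vector [X in _ = X - _](bigID [in C]) /= addrAC.
rewrite (eq_bigl [in C]) ?subrr ?add0r // => v; rewrite andb_idl //.
exact: (subvP CU).
Qed.

(** The first vector [v] is any element of [U] outside [C]; the others are then independent modulo
    [C + <[v]>], whose dimension is one larger. *)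
Lemma card_free_mod C U d : (C <= U)%VS ->
  \sum_(X : d.-tuple fT | free_mod C U X) (1 : int) =
    \prod_(i < d) (q ^+ \dim U - q ^+ (\dim C + i)).
Proof.
elim: d C => [|d IHd] C CU.
  rewrite big_ord0 (big_pred1 [tuple]) // => X.
  by rewrite tuple0 /free_mod /= span_nil addv0 addn0 !eqxx.
rewrite (reindex (fun p : fT * d.-tuple fT => cons_tuple p.1 p.2)); last first.
  exists (fun X => (thead X, [tuple of behead X])) => [[v X] _|X _] /=.
    by rewrite theadE; congr (_, _); apply: val_inj.
  by rewrite [RHS]tuple_eta; apply: val_inj.
rewrite -(pair_big_dep xpredT (fun v (X : d.-tuple fT) => free_mod C U (v :: X))
  (fun _ _ => 1)) /=.
rewrite (bigID (fun v => (v \in U) && (v \notin C))) /= [X in _ + X]big1 ?addr0; last first.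
  move=> v vUC; apply: big1 => X; rewrite free_mod_cons andbA.
  by rewrite (negPf vUC).
transitivity (\sum_(v : fT | (v \in U) && (v \notin C))
   1 * \prod_(i < d) (q ^+ \dim U - q ^+ (\dim C + i.+1))).
  apply: eq_bigr => v /andP[vU vC].
  under eq_bigl => X do rewrite free_mod_cons vU vC.
  rewrite IHd ?subv_add ?CU -?memvE // mul1r.
  by apply: eq_bigr => i _; rewrite dimv_add_line // addSnnS.
rewrite -mulr_suml card_vspaceD // big_ord_recl addn0.
by congr (_ * _); apply: eq_bigr => i _.
Qed.

(* Each [d]-dimensional subspace has [\prod_(i < d) (q ^ d - q ^ i)] ordered bases. *)
Lemma card_subspaces C U (d : nat) : (C <= U)%VS ->
  (\sum_(V : {vspace vT} | [&& (V <= U)%VS, (C :&: V == 0)%VS & \dim V == d]) (1 : int))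
     * \prod_(i < d) (q ^+ d - q ^+ i)
  = \prod_(i < d) (q ^+ \dim U - q ^+ (\dim C + i)).
Proof.
move=> CU; rewrite -card_free_mod // mulr_suml.
(* Tuples are sorted by their span; the fibre over [V] consists of the ordered bases of [V], that
   is, the [d]-tuples of [V] independent modulo 0. *)
rewrite (partition_big (fun X : d.-tuple fT => <<(X : seq vT)>>%VS)
  (fun V => [&& (V <= U)%VS, (C :&: V == 0)%VS & \dim V == d])); last first.
  move=> X /andP[/allP XU /eqP dimX].
  have := dimv_sum_cap C <<(X : seq vT)>>; have := dim_span (X : seq vT); rewrite !size_tuple in dimX *.
  rewrite dimX -dimv_eq0 => le_d eq_d.
  by rewrite (introT span_subvP) //=; lia.
apply: eq_bigr => V /and3P[VU /eqP CV /eqP dimV]; rewrite mul1r.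
transitivity (\sum_(X : d.-tuple fT | free_mod 0 V X) (1 : int)).
  by rewrite card_free_mod ?sub0v // dimV dimv0.
apply: eq_bigl => X; rewrite /free_mod add0v dimv0 add0n size_tuple.
apply/andP/andP => [[/allP XV /eqP dimX] | [_ /eqP spX]].
  have spX : <<(X : seq vT)>>%VS = V.
    by apply/eqP; rewrite -(dimv_leqif_eq _) ?dimX ?dimV //; apply/span_subvP.
  rewrite spX dimv_disjoint_sum // dimV !eqxx; split=> //; rewrite andbT.
  by apply/allP=> v /XV /(subvP VU).
by rewrite spX dimV eqxx; split=> //; apply/allP=> v; rewrite -spX; apply: memv_span.
Qed.

End CountSubspaces.

(** * Weighted sums over tuples independent of a subspace *)

Section Decompositions.
Variables (F : finFieldType) (vT : vectType F).
Implicit Types (U C V W : {vspace vT}) (s t a b : seq {vspace vT}) (x y w : opd vT).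
Local Notation q := (#|F|%:Z).

(** The factor after [g d] is the number of [d]-dimensional [V] in the sum, obtained by cancelling
    the number of ordered bases of each, which is nonzero since [q > 1]. *)
Lemma sum_subspaces (g : nat -> int) C U : (C <= U)%VS ->
  \sum_(V : {vspace vT} | (V <= U)%VS && (C :&: V == 0)%VS) g (\dim V) =
  \sum_(d < (\dim U - \dim C).+1)
    g d * (q ^+ (\dim C * d) * qbin q (\dim U - \dim C) d).
Proof.
move=> CU; set m := (\dim U - \dim C)%N.
have dimU : (\dim U = \dim C + m)%N by rewrite subnKC // dimvS.
rewrite (partition_big (fun V => inord (\dim V) : 'I_m.+1) xpredT) //=.
apply: eq_bigr => d _.
have dV V : (V <= U)%VS && (C :&: V == 0)%VS -> (\dim V < m.+1)%N.
  case/andP=> VU /eqP CV; rewrite ltnS -(leq_add2l (\dim C)) -dimU.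
  by rewrite -dimv_disjoint_sum // dimvS // subv_add CU.
transitivity (g d * \sum_(V : {vspace vT} |
    [&& (V <= U)%VS, (C :&: V == 0)%VS & \dim V == d]) 1).
  rewrite mulr_sumr; apply: eq_big => [V | V /andP[VU /eqP <-]]; last first.
    by rewrite mulr1 inordK // dV.
  rewrite [RHS]andbA; case: (boolP ((V <= U)%VS && _)) => //= /dV lt_dV.
  by rewrite -val_eqE /= inordK.
congr (_ * _).
have q1 : (1 < #|F|)%N by apply: finNzRing_gt1.
have nz : \prod_(i < d) (q ^+ d - q ^+ i) != 0.
  apply/prodf_neq0 => i _; rewrite subr_eq0 -!rmorphXn /= eqz_nat eqn_exp2l //.
  by rewrite gtn_eqF.
apply: (mulIf nz); rewrite card_subspaces // -mulrA qbin_ffact ?leq_ord //.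
rewrite exprM -[in X in X * _](card_ord d) -prodr_const -big_split /=.
by apply: eq_bigr => i _; rewrite mulrBr -!exprD -dimU.
Qed.

(** The parameter [C] absorbs blocks as they are removed from the front of [s], which makes
    recursion on the first block possible. *)
Definition indep C s : bool :=
  (0%VS \notin s) && (\dim (C + \sum_(V <- s) V) == \dim C + \sum_(V <- s) \dim V)%N.

Lemma indep_nil C : indep C [::].
Proof. by rewrite /indep !big_nil addv0 addn0 eqxx. Qed.

Lemma indep_cons C V s :
  indep C (V :: s) = [&& V != 0%VS, C :&: V == 0 & indep (C + V) s]%VS.
Proof.
rewrite /indep inE negb_or eq_sym !big_cons addvA -andbA; congr (_ && _).
rewrite andbCA; congr (_ && _); rewrite addnA.
have sumCV := dimv_sum_cap C V; rewrite -dimv_eq0.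
have le1 := (dimv_add_leqif (C + V) (\sum_(V <- s) V)%VS).1.
have le2 := dimv_leq_sum s xpredT id.
by apply/eqP/andP => [|[/eqP ? /eqP]]; [split; apply/eqP | ]; lia.
Qed.

Lemma indepS C C' s : (C' <= C)%VS -> indep C s -> indep C' s.
Proof.
elim: s C C' => [|V s IHs] C C' CC; rewrite ?indep_nil // !indep_cons.
case/and3P=> -> /eqP CV /(IHs _ (C' + V)%VS)-> /=; last exact: addvS.
by rewrite andbT -subv0 -CV capvS.
Qed.

Lemma indep_filter C p s : indep C s -> indep C (filter p s).
Proof.
elim: s C => //= V s IHs C; rewrite indep_cons => /and3P[V0 CV /IHs ind_s].
case: (p V); first by rewrite indep_cons V0 CV.
by apply: indepS ind_s; apply: addvSl.
Qed.

Lemma indep_cap0 C s V : indep C s -> V \in s -> (C :&: V = 0)%VS.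
Proof.
elim: s C => //= W s IHs C; rewrite indep_cons => /and3P[_ /eqP CW ind_s].
rewrite inE => /predU1P[-> // | /(IHs _ ind_s) CV].
by apply/eqP; rewrite -subv0 -CV capvS ?addvSl.
Qed.

Lemma indep_uniq C s : indep C s -> uniq s.
Proof.
elim: s C => //= V s IHs C; rewrite indep_cons => /and3P[V0 _ ind_s].
rewrite (IHs _ ind_s) andbT; apply: contra V0 => /(indep_cap0 ind_s).
by rewrite (capv_idPr (addvSr _ _)) => ->.
Qed.

Lemma is_opdE s : is_opd s = indep 0 s.
Proof.
rewrite /indep add0v dimv0 add0n /is_opd; apply/andP/idP => [[] // | ind_s].
split=> //; apply: (@indep_uniq 0%VS).
by rewrite /indep add0v dimv0 add0n.
Qed.

Lemma indep_cat C a b : all [pred V | (V <= C)%VS] a -> is_opd a -> indep C b ->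
  is_opd (a ++ b).
Proof.
(* The induction carries a subspace [D] of [C] that collects the blocks of [a] already passed. *)
rewrite is_opdE is_opdE; move: (0%VS) (sub0v C) => D.
elim: a D => [|V a IHa] D DC /=; first by move=> _ _; apply: indepS.
case/andP=> VC aC; rewrite !indep_cons => /and3P[-> -> ind_a] ind_b /=.
by apply: IHa; rewrite // subv_add DC.
Qed.

Definition opd_nil : opd vT := OPD (etrans (is_opdE [::]) (indep_nil 0%VS)).

Definition weight s : int := \prod_(V <- s) - q ^+ (\dim V * (\dim V).-1).

(** The empty tuple gives 1; otherwise [V] is the first block, and the tail is independent of
    [C + V]. *)
Lemma weight_recl C U : (C <= U)%VS ->
  \sum_(x : opd vT | indep C x && all [pred V | (V <= U)%VS] x) weight x =
  1 + \sum_(V : {vspace vT} | [&& V != 0, V <= U & C :&: V == 0]%VS)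
    - q ^+ (\dim V * (\dim V).-1) *
    \sum_(x : opd vT | indep (C + V) x && all [pred V | (V <= U)%VS] x) weight x.
Proof.
move=> CU; rewrite (bigD1 opd_nil) /=; last by rewrite indep_nil.
rewrite {1}/weight big_nil; congr (_ + _).
have nz x : x != opd_nil -> x = head 0%VS x :: behead x :> seq _.
  by case: x => -[|V s] os //= /eqP[]; apply: val_inj.
rewrite (partition_big (fun x : opd vT => head 0%VS x)
  (fun V => [&& V != 0, V <= U & C :&: V == 0]%VS)); last first.
  move=> x /andP[/andP[indx Ux] /nz def_x]; move: indx Ux; rewrite def_x.
  by rewrite indep_cons /= => /and3P[-> -> _] /andP[->].
apply: eq_bigr => V /and3P[V0 VU CV]; rewrite mulr_sumr.
(* The default [opd_nil] occurs only if [V :: x] is not a decomposition, and such [x] are excluded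
   because the empty tuple has been split off. *)
rewrite (reindex_onto (fun x : opd vT => insubd opd_nil (V :: x))
  (fun x : opd vT => insubd opd_nil (behead x))) /=; last first.
  move=> x /andP[/andP[_ /nz def_x] /eqP def_V].
  apply: val_inj; rewrite /= -def_V.
  have ob : is_opd (behead x).
    by have := opdP x; rewrite !is_opdE {1}def_x indep_cons => /and3P[_ _ /indepS->//]; apply: sub0v.
  by rewrite (insubdK _ ob) -def_x (valKd opd_nil).
have consK x : indep (C + V) x -> opd_seq (insubd opd_nil (V :: x)) = V :: x.
  move=> ind_x; apply: (insubdK opd_nil); rewrite -topredE /= is_opdE.
  by apply: (indepS (sub0v C)); rewrite indep_cons V0 CV.
apply: eq_big => [x | x].
  apply/idP/idP=> [|/andP[ind_x Ux]]; last first.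
    rewrite consK // indep_cons V0 CV ind_x /= VU Ux -val_eqE /= consK //= !eqxx.
    by rewrite -val_eqE /= insubdK ?eqxx //; apply: opdP.
  have [ovx | novx] := boolP (is_opd (V :: x)); last first.
    have -> : insubd opd_nil (V :: x) = opd_nil by rewrite /insubd insubN.
    by rewrite eqxx andbF.
  rewrite (insubdK opd_nil ovx : opd_seq _ = _) /= indep_cons VU => /andP[/andP[/andP[/andP[]]]].
  by case/and3P=> _ _ -> ->.
case/andP=> /andP[/andP[/andP[_ _] nz_x] _] _.
have [ovx | novx] := boolP (is_opd (V :: x)); last first.
  by move: nz_x; rewrite /insubd insubN //= eqxx.
by rewrite (insubdK opd_nil ovx : opd_seq _ = _) /weight big_cons.
Qed.

Lemma sum_weight_indep C U : (C <= U)%VS ->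
  \sum_(x : opd vT | indep C x && all [pred V | (V <= U)%VS] x) weight x =
  \prod_(\dim C <= i < \dim U) (1 - q ^+ i).
Proof.
have [m] := ubnP (\dim U - \dim C)%N; elim: m C => // m IHm C lt_m CU.
rewrite weight_recl //.
(* By induction a first block of dimension [d > 0] contributes [- g d]; the value [g 0] is the
   claimed product, so [V = 0] is added to the sum and compensated. *)
pose g d := q ^+ (d * d.-1) * \prod_(\dim C + d <= i < \dim U) (1 - q ^+ i).
transitivity (1 + (g 0 - \sum_(V : {vspace vT} | (V <= U)%VS && (C :&: V == 0)%VS) g (\dim V))).
  congr (1 + _); rewrite [X in _ - X](bigD1 0%VS) /=; last by rewrite sub0v capv0 eqxx.
  rewrite dimv0 opprD addrA subrr add0r -sumrN.
  apply: eq_big => [V | V /and3P[V0 VU /eqP CV]]; first by case: (V == 0%VS); rewrite ?andbT ?andbF.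
  have dimCV := dimv_disjoint_sum CV.
  have dim_le : (\dim (C + V) <= \dim U)%N by rewrite dimvS // subv_add CU.
  rewrite IHm ?subv_add ?CU // /g; first by rewrite dimCV mulNr.
  by move: V0; rewrite -dimv_eq0; lia.
rewrite sum_subspaces // [X in 1 + (_ - X)](_ : _ = 1).
  by rewrite addrCA subrr addr0 /g mul0n expr0 mul1r addn0.
(* The full sum over [V] is Cauchy's sum at [x = q ^+ \dim C]. *)
rewrite -[RHS](qbin_cauchy q (\dim U - \dim C) (q ^+ \dim C)).
apply: eq_bigr => d _; rewrite /g -exprM.
rewrite -[in X in \prod_(X <= _ < _) _](addnC d) -[X in \prod_(_ <= _ < X) _](subnK (dimvS CU)).
rewrite big_addn addnK.
under [in RHS]eq_bigr => i _ do rewrite -exprD addnC.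
ring.
Qed.

(** For [C = 0] the product contains the factor [1 - q ^+ 0]. *)
Lemma sum_weight_sub W : W != 0%VS ->
  \sum_(x : opd vT | all [pred V | (V <= W)%VS] x) weight x = 0.
Proof.
move=> W0; rewrite (eq_bigl (fun x : opd vT => indep 0 x && all [pred V | (V <= W)%VS] x)).
  rewrite sum_weight_indep ?sub0v // dimv0 big_ltn ?lt0n ?dimv_eq0 //.
  by rewrite expr0 subrr mul0r.
by move=> x; rewrite -is_opdE opdP.
Qed.

End Decompositions.

(** * Lower intervals, split by the first block of their upper bound *)

Lemma filter_cat_predC (T : eqType) (x0 : T) (p : pred T) (s : seq T) :
    (forall i j, (i <= j < size s)%N -> p (nth x0 s j) -> p (nth x0 s i)) ->
  s = filter p s ++ filter (predC p) s.
Proof.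
elim: s => //= z s IHs ps; case pz: (p z) => /=.
  by rewrite -IHs // => i j ij; apply: (ps i.+1 j.+1).
have np : {in s, forall y, ~~ p y}.
  move=> y /(nthP x0)[j js <-]; apply: contraFN pz.
  exact: (ps 0 j.+1).
by rewrite (eq_in_filter (a2 := pred0)) ?filter_pred0 => [|y /np/negbTE//];
   rewrite (eq_in_filter (a2 := predT)) ?filter_predT.
Qed.

Section LowerIntervals.
Variables (F : finFieldType) (vT : vectType F).
Implicit Types (C V W : {vspace vT}) (s t a b : seq {vspace vT}) (x y w : opd vT).
Local Notation opd_nil := (opd_nil vT).

Lemma is_opd_filter (p : pred {vspace vT}) s : is_opd s -> is_opd (filter p s).
Proof. by rewrite !is_opdE; apply: indep_filter. Qed.

(** Independence of [C] is thus inherited by any decomposition with a smaller sum. *)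
Lemma indepE C s : indep C s = is_opd s && (C :&: \sum_(V <- s) V == 0)%VS.
Proof.
have ind0 : indep C s -> is_opd s by rewrite is_opdE; apply: indepS (sub0v C).
case: (boolP (is_opd s)) => [os | nos]; last by apply/negP => /ind0; apply/negP.
have := dimv_sum_cap C (\sum_(V <- s) V)%VS; rewrite -dimv_eq0 /indep.
case/and3P: os => _ -> /eqP -> /= dimE.
by apply/eqP/eqP; lia.
Qed.

Lemma opd_le_sum s t : opd_le_seq s t -> (\sum_(V <- s) V <= \sum_(V <- t) V)%VS.
Proof.
move/opd_le_seqP=> le_st; rewrite [X in (X <= _)%VS](big_nth 0%VS) big_mkord.
apply/subv_sumP => i _; have [|k [l [/andP[kl lt] ik _]]] := le_st i i.
  by rewrite leqnn ltn_ord.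
have kt := leq_ltn_trans kl lt.
by rewrite (big_nth 0%VS) big_mkord; apply: (sumv_sup (Ordinal kt)).
Qed.

(** A nonzero block inside [W] lies in no other block of [W :: t], so all blocks before it must lie
    in [W] too: the blocks inside [W] form a prefix. The later ones cannot use index 0, so they are
    compared with [t]. *)
Lemma opd_le_consE W t s (inW := [pred V | (V <= W)%VS]) :
    is_opd (W :: t) -> is_opd s ->
  opd_le_seq s (W :: t) =
    (s == filter inW s ++ filter (predC inW) s) && opd_le_seq (filter (predC inW) s) t.
Proof.
move=> owt os; have nz V : V \in s -> V != 0%VS.
  by move=> Vs; apply: contraTneq Vs => ->; case/and3P: os.
apply/idP/andP=> [/opd_le_seqP le_s | [/eqP def_s /opd_le_seqP le_b]].
  have def_s : s = filter inW s ++ filter (predC inW) s.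
    apply: (@filter_cat_predC _ 0%VS) => i j ij /= jW.
    have [k [l [/andP[kl lt] ik jl]]] := le_s i j ij.
    have /andP[_ js] := ij.
    have l0 := opd_inj_nth owt lt (ltn0Sn _) (nz _ (mem_nth _ js)) jl jW.
    by move: kl ik; rewrite l0 leqn0 => /eqP->.
  split; first exact/eqP.
  set b := filter (predC inW) s in def_s *; set a := filter inW s in def_s.
  apply/opd_le_seqP=> i j ij.
  have nthb k : nth 0%VS b k = nth 0%VS s (size a + k)%N.
    by rewrite def_s nth_cat ltnNge leq_addr /= addKn.
  have [|k [l [/andP[kl lt] ik jl]]] := le_s (size a + i)%N (size a + j)%N.
    by rewrite leq_add2l [X in (_ < size X)%N]def_s size_cat ltn_add2l.
  rewrite -!nthb in ik jl.
  have bi : (i < size b)%N by lia.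
  have := mem_nth 0%VS bi; rewrite mem_filter => /andP[/= niW _].
  case: k kl ik => [|k] kl ik; first by rewrite ik in niW.
  case: l kl lt jl => [//|l] kl lt jl; exists k, l; split=> //.
  by apply/andP.
set b := filter (predC inW) s in def_s le_b; set a := filter inW s in def_s.
have aW i : (i < size a)%N -> (nth 0 a i <= W)%VS.
  by move=> /(mem_nth 0%VS); rewrite mem_filter => /andP[].
apply/opd_le_seqP=> i j /andP[ij]; rewrite {1}def_s size_cat def_s !nth_cat => js.
case: (ltnP j (size a)) => [ja | aj].
  by exists 0, 0; rewrite /= (leq_ltn_trans ij ja) !aW // (leq_ltn_trans ij).
have [k [l [/andP[kl lt] jk jl]]] : exists k l,
    [/\ (k <= l < size t)%N, (nth 0%VS b (j - size a) <= nth 0%VS t k)%VS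
               & (nth 0%VS b (j - size a) <= nth 0%VS t l)%VS].
  by apply: le_b; lia.
case: (ltnP i (size a)) => [ia | ai].
  by exists 0, l.+1; rewrite /= ltnS lt aW.
have [|k' [l' [kl' ik' jl']]] := le_b (i - size a)%N (j - size a)%N; first by lia.
by exists k'.+1, l'.+1; rewrite /= !ltnS.
Qed.

Lemma weight_cat a b : weight (a ++ b) = weight a * weight b.
Proof. by rewrite /weight big_cat. Qed.

(** Each [x] is grouped by its part [b] outside [W]; the part inside [W] is then arbitrary, so the
    sum over each group is [weight b] times a vanishing sum. *)
Lemma sum_weight_le w : opd_seq w != [::] -> \sum_(x | (x <= w)%O) weight x = 0.
Proof.
case: w => -[|W t] // owt _.
have := owt; rewrite is_opdE indep_cons add0v => /and3P[W0 _ indWt].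
pose inW := [pred V | (V <= W)%VS].
pose high x : opd vT := OPD (is_opd_filter (predC inW) (opdP x)).
pose low x : opd vT := OPD (is_opd_filter inW (opdP x)).
rewrite (partition_big high (fun b : opd vT => opd_le_seq b t)) /=; last first.
  by move=> x le_x; move: (le_x : opd_le_seq x (W :: t)); rewrite opd_le_consE ?opdP // => /andP[].
apply: big1 => b le_b.
(* The sum of [b] lies in that of [t], which meets [W] trivially. *)
have indWb : indep W b.
  have := indWt; rewrite !indepE opdP /= => /andP[_ /eqP capWt].
  by rewrite -subv0 -[X in (_ <= X)%VS]capWt capvS ?subvv ?opd_le_sum.
have catb x : all inW x -> opd_seq (insubd opd_nil (x ++ b)) = x ++ b.
  move=> xW; apply: (insubdK opd_nil); rewrite -topredE /=.
  exact: (indep_cat xW (opdP x)).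
have bW : all (predC inW) b.
  apply/allP=> V Vb /=; apply/negP => VW.
  have := indep_cap0 indWb Vb; rewrite (capv_idPr VW) => V0.
  by case/andP: indWb; rewrite -V0 Vb.
have filterb x : all inW x -> filter (predC inW) (x ++ b) = b /\ filter inW (x ++ b) = x.
  move=> xW; rewrite !filter_cat (all_filterP bW) (all_filterP xW).
  rewrite (eq_in_filter (a2 := pred0)) ?filter_pred0 /=; last first.
    by move=> V /(allP xW) /= ->.
  rewrite (eq_in_filter (s := b) (a2 := pred0)) ?filter_pred0 ?cats0 //.
  by move=> V /(allP bW) /= /negbTE.
rewrite (reindex_onto (fun x => insubd opd_nil (x ++ b)) low) /=; last first.
  move=> x /andP[le_x /eqP <-]; apply: val_inj => /=.
  move: (le_x : opd_le_seq x (W :: t)); rewrite opd_le_consE ?opdP // => /andP[/eqP def_x _].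
  by rewrite -/inW -def_x (valKd opd_nil).
transitivity (\sum_(x : opd vT | all inW x) weight x * weight b); last first.
  by rewrite -mulr_suml sum_weight_sub // mul0r.
apply: eq_big => [x | x].
  apply/idP/idP => [/andP[_ /eqP <-] | xW]; first exact: filter_all.
  have [fb fx] := filterb x xW.
  rewrite -!val_eqE /= catb // fb fx !eqxx !andbT.
  rewrite /Order.le /= /opd_le /= opd_le_consE ?catb ?fb ?fx ?eqxx //.
  by rewrite -catb // opdP.
by case/andP=> _ /eqP <-; rewrite catb ?filter_all // weight_cat.
Qed.

(** In the vanishing sum over the lower interval, [x] and the empty tuple (weight 1) are split off;
    the maximum is never strictly below [x]. The case where [x] is itself the maximum is
    included. *)
Lemma weight_moebius x : opd_seq x != [::] ->
  weight x = -1 - \sum_(y in opd_proper vT | (y < x)%O) weight y.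
Proof.
move=> x0; have := sum_weight_le x0.
rewrite (bigD1 x) ?lexx // (bigD1 opd_nil) /=; last first.
  by rewrite (opd_min x (erefl : opd_seq opd_nil = [::])) -val_eqE eq_sym.
rewrite {2}/weight big_nil => /eqP; rewrite addr_eq0 opprD => /eqP->.
congr (_ - _); apply: eq_bigl => y; rewrite (andbC (y <= x)%O) -lt_neqAle inE.
rewrite andbC; case: (boolP (y < x)%O) => [lt_yx | _]; last by rewrite !andbF.
rewrite !andbT -val_eqE /=; case: eqP => //= _; apply/esym/eqP => ytop.
by have := lt_le_trans lt_yx (opd_max x ytop); rewrite ltxx.
Qed.

End LowerIntervals.

(** * Evaluation at the maximum *)

Theorem mainTheorem9 (n q : nat) (F : finFieldType)
    (hn : (1 <= n)%N) (hq : #|F| = q) :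
  reduced_euler (order_complex (opd_proper 'rV[F]_n))
  = - (q%:Z ^+ (n * (n - 1))%N).
Proof.
have f0 : fullv != 0%VS :> {vspace 'rV[F]_n}.
  by rewrite -dimv_eq0 dimvf /dim /= mul1n -lt0n.
have otop : is_opd [:: fullv : {vspace 'rV[F]_n}].
  by rewrite is_opdE indep_cons f0 capvC capv0 eqxx indep_nil.
rewrite (reduced_euler_moebius (f := fun x : opd 'rV[F]_n => weight x)); last first.
  by move=> x; rewrite inE => /andP[x0 _]; apply: weight_moebius.
(* All proper elements lie strictly below the maximum, so [weight_moebius] there yields exactly the
   expression of Hall's theorem. *)
transitivity (weight [:: fullv : {vspace 'rV[F]_n}]).
  rewrite -[weight _]/(weight (OPD otop)) weight_moebius //.
  congr (_ - _); apply: eq_bigl => y; case: (boolP (y \in _)) => //.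
  rewrite inE => /andP[_ ytop]; rewrite lt_neqAle opd_max // andbT.
  by apply/esym; rewrite -val_eqE.
by rewrite /weight big_seq1 dimvf /dim /= mul1n subn1 hq.
Qed.
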